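(* Let $N\ge1$ and let $f\in\mathbb{R}^N$. Then the unique solution of the problem $$\inf\{\|f-u\|_1:\ u\in\mathbb{R}^N,\ \|u\|_\infty\le1\}$$ is given by $P(f)$.
   Context: For $x\in\mathbb{R}^N$, $\|x\|_1=\sum_{i=1}^N|x_i|$ and $\|x\|_\infty=\max_{1\le i\le N}|x_i|$. The map $\alpha:\mathbb{R}\to\mathbb{R}$ is defined by $\alpha(t)=-1$ if $t\le-1$, $\alpha(t)=t$ if $-1<t<1$, and $\alpha(t)=1$ if $t\ge1$. The map $P:\mathbb{R}^N\to\mathbb{R}^N$ is defined by $(P(x))_i=\alpha(x_i)$ for $i=1,\dots,N$. *)

(* Defs.v *)
From mathcomp Require Import all_boot all_order all_algebra.
From mathcomp Require Import all_classical all_reals all_analysis.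

Set Implicit Arguments.
Unset Strict Implicit.
Unset Printing Implicit Defensive.

Import Order.TTheory GRing.Theory Num.Theory.
Import numFieldNormedType.Exports.

Local Open Scope classical_set_scope.
Local Open Scope ring_scope.

(* Vectors of R^N are row vectors 'rV[R]_N.  The max norm of x is the library
   norm `|x| on matrices (mx_norm, see mx_normrE), so only the l^1 norm has to
   be defined. *)
Definition norm1 (R : realType) (N : nat) (x : 'rV[R]_N) : R :=
  \sum_(i < N) `|x ord0 i|.

Definition alpha (R : realType) (t : R) : R :=
  if t <= -1 then -1 else if t < 1 then t else 1.

Definition P (R : realType) (N : nat) (x : 'rV[R]_N) : 'rV[R]_N :=
  \row_(i < N) alpha (x ord0 i).

Definition feasible (R : realType) (N : nat) : set 'rV[R]_N :=
  [set u | `|u| <= 1].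

(* A solution is a feasible point at which the infimum is attained.  The
   library's inf is a junk value only on sets that are empty or unbounded
   below; here the set contains norm1 f (u = 0) and is bounded below by 0. *)
Definition is_solution (R : realType) (N : nat) (f u : 'rV[R]_N) : Prop :=
  feasible u /\ norm1 (f - u) = inf [set norm1 (f - v) | v in @feasible R N].

(* Main.v *)
Require Import Defs.
From mathcomp Require Import all_boot all_order all_algebra.
From mathcomp Require Import all_classical all_reals all_analysis.
From mathcomp Require Import lra.

Import Order.TTheory GRing.Theory Num.Theory.
Import numFieldNormedType.Exports.

Local Open Scope classical_set_scope.
Local Open Scope ring_scope.

(** The problem decouples over the coordinates: the constraint on the max norm
    says that each coordinate of [u] lies in [[-1, 1]], and the objective is the
    sum of the distances [`|f_i - u_i|].  In one coordinate, [alpha t] is the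
    only point of [[-1, 1]] nearest to [t] ([leif_dist_alpha]).  Summing these
    inequalities, each with its equality case, gives [leif_norm1_P]: among
    feasible points, the distance to [f] is at least that of [P f], with
    equality only at [P f] itself.  The minimum is thus attained, so it equals
    the infimum, and any solution must fall in the equality case. *)

Lemma feasible_coordP (R : realType) (N : nat) (u : 'rV[R]_N) :
  feasible u <-> forall i, `|u ord0 i| <= 1.
Proof.
rewrite /feasible /= [X in X <= 1](mx_normrE u); split=> [u1 i|u1].
  apply: le_trans u1.
  exact: (le_bigmax _ (fun ij => `|u ij.1 ij.2|) (ord0, i)).
by apply: bigmax_le => [|[i j] _]; [exact: ler01 | rewrite ord1; exact: u1].
Qed.

Lemma norm_alpha_le1 (R : realType) (t : R) : `|alpha t| <= 1.
Proof.
rewrite ler_norml /alpha; case: (leP t) => ?; last case: (ltP t) => ?.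
all: by apply/andP; split; lra.
Qed.

(** When [t] lies outside [[-1, 1]], all of the interval is on the same side of
    [t], so the distance to [t] is strictly monotone on it and is minimal only at
    the endpoint [alpha t]; otherwise [alpha t = t] is at distance zero. *)
Lemma leif_dist_alpha (R : realType) (t s : R) : `|s| <= 1 ->
  `|t - alpha t| <= `|t - s| ?= iff (s == alpha t).
Proof.
rewrite ler_norml => /andP[s_ge s_le]; rewrite /alpha.
case: (leP t) => [t_le|t_gt]; last case: (ltP t) => [t_lt|t_ge].
- rewrite !ler0_norm; [|lra|lra].
  by split; [lra | apply/eqP/eqP; lra].
- rewrite subrr normr0; split; first exact: normr_ge0.
  by rewrite eq_sym normr_eq0 subr_eq0 eq_sym.
- rewrite !ger0_norm; [|lra|lra].
  by split; [lra | apply/eqP/eqP; lra].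
Qed.

Lemma feasible_P (R : realType) (N : nat) (f : 'rV[R]_N) : feasible (P f).
Proof. by apply/feasible_coordP => i; rewrite mxE norm_alpha_le1. Qed.

(** The equality cases of the coordinatewise bounds combine: a sum of
    inequalities is an equality only if every term is. *)
Lemma leif_norm1_P (R : realType) (N : nat) (f u : 'rV[R]_N) : feasible u ->
  norm1 (f - P f) <= norm1 (f - u) ?= iff (u == P f).
Proof.
move=> /feasible_coordP u1.
have -> : (u == P f) = [forall i, u ord0 i == alpha (f ord0 i)].
  apply/eqP/forallP => [-> i|uE]; first by rewrite mxE.
  by apply/rowP => i; rewrite mxE; exact/eqP.
by apply: leif_sum => i _; rewrite !mxE; exact: leif_dist_alpha.
Qed.

Lemma inf_norm1 (R : realType) (N : nat) (f : 'rV[R]_N) :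
  inf [set norm1 (f - v) | v in @feasible R N] = norm1 (f - P f).
Proof.
have lb : lbound [set norm1 (f - v) | v in @feasible R N] (norm1 (f - P f)).
  by move=> _ [v v1 <-]; exact: (leif_norm1_P _ _ _ _ v1).1.
have attained : [set norm1 (f - v) | v in @feasible R N] (norm1 (f - P f)).
  by exists (P f) => //; exact: feasible_P.
apply/le_anti/andP; split.
  by apply: ge_inf => //; exists (norm1 (f - P f)).
by apply: lb_le_inf => //; exists (norm1 (f - P f)).
Qed.

Theorem lemma4p2 (R : realType) (N : nat) (hN : (1 <= N)%N) (f : 'rV[R]_N) :
  is_solution f (P f) /\ forall u : 'rV[R]_N, is_solution f u -> u = P f.
Proof.
rewrite /is_solution inf_norm1; split; first by split; first exact: feasible_P.
move=> u [u1 uE]; apply/eqP.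
by rewrite -(leif_norm1_P _ _ _ _ u1).2 uE.
Qed.
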